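(* For $|q|<1$ and $c\in\mathbb{C}$, \[ \sum_{n=0}^{\infty} \mathrm{FFW}_{c}(n) q^n = -\sum_{n=1}^{\infty}\frac{(-c)^{n}q^{n(n+1)/2}}{(q)_n(1-q^n)}= \sum_{n=1}^{\infty} \frac{q^n}{1-q^n} -\sum_{n=1}^{\infty}\frac{(c)_n}{1-q^n}q^n. \]
   Context: For a partition $\pi$, $\#(\pi)$ denotes its number of parts and $s(\pi)$ its smallest part. Let $\mathcal{D}_n$ be the set of partitions of $n$ into distinct parts. For $c\in\mathbb{C}$ define $\mathrm{FFW}_c(n)=\sum_{\pi\in\mathcal{D}_n}(-c)^{\#(\pi)}s(\pi)$ for $n\ge1$, and $\mathrm{FFW}_c(0)=0$. For $x\in\mathbb{C}$, $(x)_n=(x;q)_n=\prod_{j=0}^{n-1}(1-xq^j)$.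
   Formalization: FFW_c(n) is taken with a leading minus sign, as −Σ(−c)^{#(π)} s(π), since with the printed definition the first equality fails (the coefficient of q is −c on the left but c in the other two expressions). *)

(* Defs.v *)
From HB Require Import structures.
From mathcomp Require Import all_boot all_order all_algebra.
From mathcomp Require Import all_classical all_reals all_analysis.
From mathcomp Require Import complex.

Set Implicit Arguments.
Unset Strict Implicit.
Unset Printing Implicit Defensive.

Import Order.TTheory GRing.Theory Num.Theory.
Import numFieldNormedType.Exports.

Local Open Scope ring_scope.
Local Open Scope classical_set_scope.

(* The topology on R[i] is the one induced by the complex modulus: that of    *)
(* R[i] as a normed module over itself. MathComp-Analysis provides it for     *)
(* abstract number fields, but it is not inferred for the concrete type R[i]. *)
HB.instance Definition _ (R : realType) :=
  NormedModule.copy R[i] (R[i] : numClosedFieldType)^o.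

(* A partition into distinct parts is determined by the set of its parts. For *)
(* a partition of n these are at most n, hence a set of elements of 'I_n.+1.  *)
Definition distinct_partitions (n : nat) : {set {set 'I_n.+1}} :=
  [set p : {set 'I_n.+1} | (ord0 \notin p) && (\sum_(i in p) i == n)%N].

Definition num_parts (n : nat) (p : {set 'I_n.+1}) : nat := #|p|.

(* As every part is at most n, starting the minimum at n has no effect when p *)
(* is nonempty.                                                               *)
Definition smallest_part (n : nat) (p : {set 'I_n.+1}) : nat :=
  \big[minn/n]_(i in p) (i : nat).

(* The sum carries a leading minus sign (equivalently, the weight of p is     *)
(* (-1)^(#p - 1) c^#p s(p)), so that c = 1 gives the classical                *)
(* Fokkink-Fokkink-Wang sum, which is the number of divisors of n. Without    *)
(* this sign FFW_c(1) would be -c, whereas the two series to which its        *)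
(* generating function is claimed to be equal have q-coefficient c.           *)
Definition FFW (R : realType) (c : R[i]) (n : nat) : R[i] :=
  if n is 0%N then 0
  else - \sum_(p in distinct_partitions n)
           (- c) ^+ num_parts p * (smallest_part p)%:R.

Definition qpoch (R : realType) (x q : R[i]) (n : nat) : R[i] :=
  \prod_(j < n) (1 - x * q ^+ j).

Definition summable_from (R : realType) (m : nat) (u : nat -> R[i]) : Prop :=
  cvgn (fun N => \sum_(m <= n < N) u n).

Definition sum_from (R : realType) (m : nat) (u : nat -> R[i]) : R[i] :=
  \big[+%R/0]_(m <= n <oo) u n.

(* Main.v *)
(* Writing F for any of the three functions of c (the generating function of  *)
(* FFW_c, minus the q-series with quadratic exponents, and the difference of  *)
(* the last two series), one has F(c) - F(cq) = 1 - E(c), where E(c) is the   *)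
(* infinite product (1 - cq)(1 - cq^2)..., expanded by Euler as a series in   *)
(* c. Moreover F(c) = O(c) near 0. Hence the difference of two such functions *)
(* is invariant under c -> cq, and iterating this map shows that it vanishes. *)
(* For FFW_c the functional equation comes from counting a partition once for *)
(* every j up to its smallest part, so that the generating function is the    *)
(* limit of minus the sum over 1 <= j <= N of (1 - cq^j)...(1 - cq^N) - 1.    *)
Require Import Defs.
From mathcomp Require Import all_boot all_order all_algebra.
From mathcomp Require Import all_classical all_reals all_analysis.
From mathcomp Require Import complex.
From mathcomp Require Import ring lra zify.
Import Order.TTheory GRing.Theory Num.Theory.
Import numFieldNormedType.Exports.
Local Open Scope ring_scope.
Local Open Scope classical_set_scope.

Set Implicit Arguments.
Unset Strict Implicit.
Unset Printing Implicit Defensive.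

(** Each side is a function of [c] that is O(c) near 0, and the proof never expands it in powers of
    [c]. By [small_q_shift_unique], such a function is determined by its difference under
    [c -> c * q]: if two have the same difference, then f - g takes the same value at [c] and at
    every [c * q ^+ k], and these points tend to 0. The common difference is 1 - E(c). For the
    quadratic-exponent series it appears termwise, because [1 - q ^+ n] cancels
    ([sum_eulerLambertTerm_qshift]). For the difference of the last two series it appears by
    telescoping ([sum_diffTerm_qshift]). For the partition sum it is the limit of a finite identity
    between polynomials evaluated at [q] ([horner_ffwPoly_recl], [cvg_ffwPoly]). The first
    computation yields E as a series and the other two as a limit of finite products; Euler's
    identity [cvg_qpoch] reconciles them. *)

Section Normc.

(** * The real-valued complex modulus, and limits in [R[i]] expressed through it *)

Variable R : realType.
Implicit Types x y z : R[i].
Local Notation normc := (@Normc.normc R).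

Lemma normcEC z : `|z| = (normc z)%:C%C.
Proof. by case: z. Qed.

Lemma normc_ge0 z : 0 <= normc z.
Proof. by rewrite -lecR -normcEC; exact: normr_ge0. Qed.

Lemma normc_triangle x y : normc (x + y) <= normc x + normc y.
Proof. by rewrite -lecR rmorphD /= -!normcEC ler_normD. Qed.

Lemma normc_opp z : normc (- z) = normc z.
Proof. by apply: complexI; rewrite -!normcEC normrN. Qed.

Lemma normcX z n : normc (z ^+ n) = normc z ^+ n.
Proof. by apply: complexI; rewrite rmorphXn /= -!normcEC normrX. Qed.

Lemma normc_sum (I : Type) (s : seq I) (P : pred I) (F : I -> R[i]) :
  normc (\sum_(i <- s | P i) F i) <= \sum_(i <- s | P i) normc (F i).
Proof.
elim/big_rec2: _ => [|i y x _ h]; first by rewrite Normc.normc0.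
by rewrite (le_trans (normc_triangle _ _)) ?lerD2l.
Qed.

Lemma normc_Re z : `|complex.Re z| <= normc z.
Proof. by rewrite -lecR -normcEC; exact: normc_ge_Re. Qed.

Lemma normc_Im z : `|complex.Im z| <= normc z.
Proof.
case: z => a b /=; rewrite -sqrtr_sqr ler_wsqrtr // lerDr; exact: sqr_ge0.
Qed.

Lemma normc_le_ReIm z : normc z <= `|complex.Re z| + `|complex.Im z|.
Proof.
case: z => a b /=; rewrite -(ler_pXn2r (n:=2)) ?nnegrE ?addr_ge0 //.
rewrite sqr_sqrtr ?addr_ge0 ?sqr_ge0 // sqrrD !real_normK ?num_real //.
by rewrite lerD2r lerDl mulrn_wge0 // mulr_ge0.
Qed.

Lemma cvg_normcP (u : nat -> R[i]) (l : R[i]) :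
  u @ \oo --> l <-> (fun n => normc (l - u n)) @ \oo --> (0 : R).
Proof.
split=> [/cvgrPdist_lt h|/cvgrPdist_lt h].
  apply/cvgrPdist_lt => e e0; have := h e%:C%C; rewrite ltcR => /(_ e0).
  apply: filterS => n; rewrite normcEC ltcR sub0r normrN ger0_norm //.
  exact: normc_ge0.
(* A positive element of [R[i]] has zero imaginary part, so a complex epsilon is a real one. *)
apply/cvgrPdist_lt => -[e e'] /=; rewrite ltcE /= => /andP[/eqP -> e0].
apply: filterS (h e e0) => n; rewrite sub0r normrN ger0_norm ?normc_ge0 //.
by rewrite normcEC ltcR.
Qed.

Lemma cvg_normc_le (u : nat -> R[i]) (v : nat -> R) (l : R[i]) :
  (forall n, normc (l - u n) <= v n) -> v @ \oo --> (0 : R) -> u @ \oo --> l.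
Proof.
move=> huv hv; apply/cvg_normcP; apply: squeeze_cvgr (cvg_cst 0) hv.
by near=> n; rewrite normc_ge0 huv.
Unshelve. all: by end_near. Qed.

Lemma normc_lim_le (u : nat -> R[i]) (l : R[i]) (B : R) :
  u @ \oo --> l -> (forall n, normc (u n) <= B) -> normc l <= B.
Proof.
move=> /cvg_normcP/cvgrPdist_lt hu hB; apply/ler_addgt0Pr => e e0.
have [N _ /(_ N (leqnn N)) /=] := hu e e0.
rewrite sub0r normrN ger0_norm ?normc_ge0 // => /ltW hN.
rewrite -[l](subrK (u N)) addrC.
by rewrite (le_trans (normc_triangle _ _)) ?lerD ?hB ?hN.
Qed.

Lemma cvg_complex (u : nat -> R[i]) (a b : R) :
  (fun n => complex.Re (u n)) @ \oo --> a ->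
  (fun n => complex.Im (u n)) @ \oo --> b ->
  u @ \oo --> (a +i* b : R[i])%C.
Proof.
move=> ha hb; apply: (@cvg_normc_le _
  (fun n => `|complex.Re (u n) - a| + `|complex.Im (u n) - b|)) => [n|].
  rewrite -normc_opp opprB (le_trans (normc_le_ReIm _)) //.
  by case: (u n).
rewrite -[0]addr0 -(@normr0 _ R); apply: cvgD; apply: cvg_norm.
  by rewrite -[X in _ --> X](subrr a); apply: cvgB ha (cvg_cst a).
by rewrite -[X in _ --> X](subrr b); apply: cvgB hb (cvg_cst b).
Qed.

Lemma cvgn_limE (u : nat -> R[i]) (l : R[i]) : u @ \oo --> l -> limn u = l.
Proof. by move=> h; apply: cvg_lim. Qed.

Lemma cvgn_sub (u v : nat -> R[i]) (a b : R[i]) :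
  u @ \oo --> a -> v @ \oo --> b ->
  (fun n => u n - v n) @ \oo --> (a - b : R[i]).
Proof. by move=> hu hv; exact: (cvgB hu hv). Qed.

End Normc.

(** * Series dominated by a geometric series *)

Section Geometric.
Variables (R : realType) (K r : R).
Hypotheses (K0 : 0 <= K) (r0 : 0 <= r) (r1 : r < 1).
Local Notation normc := (@Normc.normc R).

Lemma geometric_sum_le m n : \sum_(m <= k < n) r ^+ k <= r ^+ m / (1 - r).
Proof.
have h : 0 < 1 - r by rewrite subr_gt0.
have [nm|mn] := leqP n m.
  by rewrite big_geq // divr_ge0 ?exprn_ge0 // ltW.
rewrite ler_pdivlMr // mulr_suml.
have -> : \sum_(m <= k < n) r ^+ k * (1 - r) = r ^+ m - r ^+ n.
  rewrite (telescope_sumr_eq (fun k => - r ^+ k)) ?(ltnW mn) //.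
    by rewrite opprK addrC.
  by move=> k _; rewrite exprS; ring.
by rewrite gerBl exprn_ge0.
Qed.

Lemma cvg_geometric0 : (fun n => K * r ^+ n) @ \oo --> (0 : R).
Proof. by apply: cvg_geometric; rewrite ger0_norm. Qed.

Variable u : nat -> R[i].
Hypothesis hu : forall n, normc (u n) <= K * r ^+ n.

Lemma normc_sum_geometric m n :
  normc (\sum_(m <= k < n) u k) <= K * r ^+ m / (1 - r).
Proof.
apply: le_trans (normc_sum _ _ _) _.
apply: le_trans (ler_sum _ (fun k _ => hu k)) _.
by rewrite -mulr_sumr -mulrA ler_wpM2l // geometric_sum_le.
Qed.

(** The real and imaginary parts converge absolutely by comparison, so only real series are
    needed. *)
Lemma cvg_series_dominated : cvgn (fun N => \sum_(0 <= n < N) u n).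
Proof.
have cvgR (f : nat -> R) : (forall n, `|f n| <= normc (u n)) -> cvgn (series f).
  move=> hf; apply: normed_cvg; apply: (@series_le_cvg _ _ (geometric K r)).
  - by move=> n /=.
  - by move=> n; rewrite /geometric /= mulr_ge0 ?exprn_ge0.
  - by move=> n; exact: le_trans (hf n) (hu n).
  - by apply: is_cvg_geometric_series; rewrite ger0_norm.
have cRe := cvgR _ (fun n => normc_Re (u n)).
have cIm := cvgR _ (fun n => normc_Im (u n)).
apply: cvgP; apply: cvg_complex.
- rewrite [X in X @ _](_ : _ = series (fun n => complex.Re (u n))).
    exact: cRe.
  by apply/funext => N; rewrite raddf_sum.
- rewrite [X in X @ _](_ : _ = series (fun n => complex.Im (u n))).
    exact: cIm.
  by apply/funext => N; rewrite raddf_sum.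
Qed.

Lemma cvg_sum_from : (fun N => \sum_(0 <= n < N) u n) @ \oo --> sum_from 0 u.
Proof. exact: cvg_series_dominated. Qed.

Lemma normc_sum_from_le : normc (sum_from 0 u) <= K / (1 - r).
Proof.
apply: normc_lim_le cvg_sum_from _ => n.
by have := normc_sum_geometric 0 n; rewrite expr0 mulr1.
Qed.

End Geometric.

(** Expanded, the product minus 1 is a polynomial in the [z k] with nonnegative coefficients and no
    constant term, so the triangle inequality applies monomial by monomial. The induction does this
    without expanding. *)
Lemma normc_prod_sub1_le (R : realType) (z : nat -> R[i]) m n :
  Normc.normc (\prod_(m <= k < n) (1 + z k) - 1) <=
  \prod_(m <= k < n) (1 + Normc.normc (z k)) - 1.
Proof.
elim: n => [|n IH]; first by rewrite !big_geq // !subrr Normc.normc0.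
have [mn|nm] := leqP m n; last by rewrite !big_geq // !subrr Normc.normc0.
rewrite !big_nat_recr //=; move: IH.
set p := \prod_(m <= k < n) (1 + z k); set P := \prod_(m <= k < n) _ => IH.
have -> : p * (1 + z n) - 1 = (p - 1) * (1 + z n) + z n by ring.
have -> : P * (1 + Normc.normc (z n)) - 1 =
  (P - 1) * (1 + Normc.normc (z n)) + Normc.normc (z n) by ring.
rewrite (le_trans (normc_triangle _ _)) // lerD2r Normc.normcM.
rewrite ler_pM ?normc_ge0 //.
by rewrite (le_trans (normc_triangle _ _)) // Normc.normc1.
Qed.

(** * Bounds on finite products, uniform in their length *)

Section ProductBound.
Variables (R : realType) (x r : R).
Hypotheses (x0 : 0 <= x) (r0 : 0 <= r) (r1 : r < 1).

Lemma prod_le_expR m n :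
  \prod_(m <= k < n) (1 + x * r ^+ k) <= expR (x * (r ^+ m / (1 - r))).
Proof.
apply: (@le_trans _ _ (\prod_(m <= k < n) expR (x * r ^+ k))).
  apply: ler_prod => k _.
  by rewrite expR_ge1Dx addr_ge0 // mulr_ge0 // exprn_ge0.
rewrite -expR_sum ler_expR -mulr_sumr ler_wpM2l //.
exact: geometric_sum_le.
Qed.

(** The factor [x] gives the O(c) behaviour, and [r ^+ m] makes the sum over the starting index of
    tail products converge. *)
Lemma prod_sub1_le m n :
  \prod_(m <= k < n) (1 + x * r ^+ k) - 1 <=
  x / (1 - r) * expR (x / (1 - r)) * r ^+ m.
Proof.
have h : 0 < 1 - r by rewrite subr_gt0.
rewrite (le_trans (lerB (prod_le_expR m n) (lexx 1))) //.
set t := x * (r ^+ m / (1 - r)).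
have t0 : 0 <= t by rewrite mulr_ge0 // divr_ge0 ?exprn_ge0 // ltW.
have -> : x / (1 - r) * expR (x / (1 - r)) * r ^+ m = t * expR (x / (1 - r)).
  by rewrite /t; ring.
have : t * expR t <= t * expR (x / (1 - r)).
  rewrite ler_wpM2l // ler_expR /t mulrA mulrAC.
  by rewrite ler_piMr ?exprn_ile1 ?(ltW r1) // divr_ge0 // ltW.
apply: le_trans.
(* expR t - 1 <= t * expR t, as 1 - t <= expR (- t) *)
have := expR_ge1Dx (- t); rewrite expRN => /(ler_wpM2r (expR_ge0 t)).
by rewrite mulVf ?expR_eq0 //; lra.
Qed.

End ProductBound.

(** * Uniqueness for the q-difference equation, and bounds on q-factorials *)

Section QSeries.
Variables (R : realType) (q : R[i]).
Local Notation normc := (@Normc.normc R).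
Local Notation r := (normc q).
Hypothesis r1 : r < 1.
Let r0 : 0 <= r := normc_ge0 q.
Let h1r : 0 < 1 - r. Proof. by rewrite subr_gt0. Qed.

(** An explicit, global form of O(c) at 0. The exponential is what the product bounds provide; it
    stays bounded along [c * q ^+ k]. *)
Definition small (f : R[i] -> R[i]) := exists K D : R,
  [/\ 0 <= K, 0 <= D &
    forall c, normc (f c) <= K * (normc c * expR (D * normc c))].

Lemma small_q_shift_unique (f g : R[i] -> R[i]) : small f -> small g ->
  (forall c, f c - f (c * q) = g c - g (c * q)) -> f =1 g.
Proof.
move=> [K [D [K0 D0 hf]]] [K' [D' [K'0 D'0 hg]]] hfg c.
have hk k : f c - g c = f (c * q ^+ k) - g (c * q ^+ k).
  elim: k => [|k ->]; first by rewrite mulr1.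
  have /eqP := hfg (c * q ^+ k).
  by rewrite -mulrA -exprSr subr_eq => /eqP ->; ring.
pose M := (K * expR (D * normc c) + K' * expR (D' * normc c)) * normc c.
(* For every [k] the distance from 0 to [f c - g c] is at most [M * r ^+ k], so the zero sequence
   converges to this difference. *)
have lim0 : (fun k : nat => 0 : R[i]) @ \oo --> (f c - g c : R[i]).
  apply: (cvg_normc_le (v := fun k => M * r ^+ k)); last exact: cvg_geometric0.
  move=> k; rewrite subr0 (hk k) (le_trans (normc_triangle _ _)) // normc_opp.
  rewrite (le_trans (lerD (hf _) (hg _))) // Normc.normcM normcX.
  have le_exp E : 0 <= E -> expR (E * (normc c * r ^+ k)) <= expR (E * normc c).
    move=> E0; rewrite ler_expR ler_wpM2l //.
    by rewrite ler_piMr ?exprn_ile1 ?normc_ge0 ?(ltW r1).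
  rewrite /M mulrDl mulrDl; apply: lerD.
    rewrite -!mulrA ler_wpM2l // [leRHS]mulrC mulrA.
    rewrite ler_wpM2l ?mulr_ge0 ?exprn_ge0 ?normc_ge0 //.
    exact: le_exp.
  rewrite -!mulrA ler_wpM2l // [leRHS]mulrC mulrA.
  rewrite ler_wpM2l ?mulr_ge0 ?exprn_ge0 ?normc_ge0 //.
  exact: le_exp.
apply/eqP; rewrite -subr_eq0 -(cvgn_limE lim0); apply/eqP/cvgn_limE.
exact: cvg_cst.
Qed.

Lemma normc_inv_1subX n : normc (1 - q ^+ n)^-1 <= (1 - r)^-1.
Proof.
case: n => [|n].
  by rewrite subrr invr0 Normc.normc0 invr_ge0 ltW.
have h : 1 - r <= normc (1 - q ^+ n.+1).
  rewrite lerBlDr -[leLHS](@Normc.normc1 R) -[X in normc X](subrK (q ^+ n.+1)).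
  rewrite (le_trans (normc_triangle _ _)) // lerD2l normcX exprS.
  by rewrite ler_piMr ?exprn_ile1 ?(ltW r1).
by rewrite Normc.normcV lef_pV2 ?posrE // (lt_le_trans h1r).
Qed.

Lemma subX_neq0 n : 1 - q ^+ n.+1 != 0.
Proof.
rewrite subr_eq0; apply/eqP => h; have := congr1 normc h.
rewrite Normc.normc1 normcX => h'.
by have : r ^+ n.+1 < 1; [rewrite exprn_ilt1 | rewrite -h' ltxx].
Qed.

Lemma qpochS (x : R[i]) n : qpoch x q n.+1 = qpoch x q n * (1 - x * q ^+ n).
Proof. by rewrite /qpoch big_ord_recr. Qed.

Lemma qpoch_recl (x : R[i]) n : qpoch x q n.+1 = (1 - x) * qpoch (x * q) q n.
Proof.
rewrite /qpoch big_ord_recl mulr1; congr (_ * _).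
by apply: eq_bigr => i _; rewrite /= exprS mulrA.
Qed.

Lemma qpoch0 (x : R[i]) : qpoch x q 0 = 1.
Proof. by rewrite /qpoch big_ord0. Qed.

Lemma normc_qpoch_sub1 c n :
  normc (1 - qpoch c q n) <=
  (1 - r)^-1 * (normc c * expR ((1 - r)^-1 * normc c)).
Proof.
rewrite -normc_opp opprB /qpoch -(big_mkord xpredT (fun j => 1 - c * q ^+ j)).
have -> : \prod_(0 <= j < n) (1 - c * q ^+ j) =
  \prod_(0 <= j < n) (1 + (- c * q ^+ j)).
  by apply: eq_bigr => j _; rewrite mulNr.
apply: le_trans (normc_prod_sub1_le _ _ _) _.
under eq_bigr do rewrite Normc.normcM normc_opp normcX.
apply: le_trans (prod_sub1_le (normc_ge0 _) _ _ _ _) _ => //.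
by rewrite expr0 mulr1 [(1 - r)^-1 * normc c]mulrC mulrCA mulrA.
Qed.

End QSeries.

(** * Euler's expansion of the infinite product (1 - cq)(1 - cq^2).. *)

Section Euler.
Variables (R : realType) (q : R[i]).
Local Notation normc := (@Normc.normc R).
Local Notation r := (normc q).
Hypothesis r1 : r < 1.
Let r0 : 0 <= r := normc_ge0 q.
Let h1r : 0 < 1 - r. Proof. by rewrite subr_gt0. Qed.

Definition eulerTerm (c : R[i]) n : R[i] :=
  (- c) ^+ n * q ^+ (n * n.+1)./2 / qpoch q q n.

Lemma triangularS n : (n.+1 * n.+2)./2 = ((n * n.+1)./2 + n.+1)%N.
Proof.
have -> : (n.+1 * n.+2 = n * n.+1 + n.+1.*2)%N by rewrite -muln2; nia.
by rewrite halfD odd_double andbF doubleK.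
Qed.

Lemma eulerTermS c n :
  eulerTerm c n.+1 = eulerTerm c n * (- c * (q ^+ n.+1 / (1 - q ^+ n.+1))).
Proof.
rewrite /eulerTerm qpochS invfM triangularS exprD exprSr.
by rewrite -[q * q ^+ n]exprS; ring.
Qed.

Lemma eulerTerm0 c : eulerTerm c 0 = 1.
Proof. by rewrite /eulerTerm qpoch0 !expr0 !mul1r invr1. Qed.

Lemma eulerTerm_shift c n : eulerTerm (c * q) n = eulerTerm c n * q ^+ n.
Proof. by rewrite /eulerTerm -mulNr exprMn; ring. Qed.

(** This is E(c) = (1 - cq) E(cq) read off in each degree; it holds because
    [eulerTerm c n.+1 * (1 - q ^+ n.+1)] equals [- c * q * eulerTerm (c * q) n]. *)
Lemma eulerTerm_rec c n :
  eulerTerm c n.+1 = eulerTerm (c * q) n.+1 - c * q * eulerTerm (c * q) n.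
Proof.
rewrite !eulerTerm_shift eulerTermS exprS.
have := subX_neq0 r1 n; rewrite exprS; set Q := q ^+ n => h.
by field.
Qed.

Local Notation y c := (normc c / (1 - r)).

Lemma normc_eulerTermS_le c n :
  normc (eulerTerm c n.+1) <= normc (eulerTerm c n) * (y c * r ^+ n.+1).
Proof.
rewrite eulerTermS Normc.normcM ler_wpM2l ?normc_ge0 // !Normc.normcM.
rewrite normc_opp normcX -mulrA ler_wpM2l ?normc_ge0 // mulrC.
by rewrite ler_wpM2r ?exprn_ge0 ?normc_inv_1subX.
Qed.

Lemma normc_eulerTerm_le c n :
  normc (eulerTerm c n) <= expR (y c / (1 - r)) * r ^+ n.
Proof.
have y0 : 0 <= y c by rewrite divr_ge0 ?normc_ge0 // ltW.
(* The ratio of consecutive terms is bounded by [y c * r ^+ n.+1], hence by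
   [r * (1 + y c * r ^+ n)]; multiplying these bounds gives the product. *)
suff h : normc (eulerTerm c n) <=
    r ^+ n * \prod_(0 <= k < n) (1 + y c * r ^+ k).
  rewrite mulrC (le_trans h) // ler_wpM2l ?exprn_ge0 //.
  by have := prod_le_expR y0 r0 r1 0 n; rewrite expr0 mul1r.
elim: n => [|n IH].
  by rewrite eulerTerm0 Normc.normc1 big_geq // expr0 mulr1.
apply: le_trans (normc_eulerTermS_le _ _) _.
rewrite big_nat_recr //=.
have rn : 0 <= r ^+ n by rewrite exprn_ge0.
have P0 : 0 <= \prod_(0 <= k < n) (1 + y c * r ^+ k).
  by apply: prodr_ge0 => k _; rewrite addr_ge0 // mulr_ge0 // exprn_ge0.
have rn1 : 0 <= r ^+ n.+1 by rewrite exprn_ge0.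
move: IH; set P := \prod_(0 <= k < n) _ in P0 * => IH.
apply: le_trans (_ : (r ^+ n * P) * (y c * r ^+ n.+1) <= _).
  by rewrite ler_wpM2r // mulr_ge0.
rewrite -subr_ge0.
have -> : r ^+ n.+1 * (P * (1 + y c * r ^+ n))
  - r ^+ n * P * (y c * r ^+ n.+1) = r ^+ n.+1 * P by ring.
by rewrite mulr_ge0.
Qed.

Lemma normc_eulerTermS_small c n :
  normc (eulerTerm c n.+1) <= y c * expR (y c / (1 - r)) * r ^+ n.+1.
Proof.
apply: le_trans (normc_eulerTermS_le _ _) _.
have y0 : 0 <= y c by rewrite divr_ge0 ?normc_ge0 // ltW.
rewrite mulrA ler_wpM2r ?exprn_ge0 // mulrC ler_wpM2l //.
rewrite (le_trans (normc_eulerTerm_le _ _)) // ler_piMr ?expR_ge0 //.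
by rewrite exprn_ile1 // ltW.
Qed.

Definition euler (c : R[i]) : R[i] := sum_from 0 (eulerTerm c).

Lemma cvg_euler c :
  (fun N => \sum_(0 <= n < N) eulerTerm c n) @ \oo --> euler c.
Proof.
exact: (cvg_sum_from (expR_ge0 _) r0 r1 (normc_eulerTerm_le c)).
Qed.

Lemma euler_rec c : euler c = (1 - c * q) * euler (c * q).
Proof.
rewrite -(cvgn_limE (@cvg_euler c)); apply: cvgn_limE.
have h (N : nat) : \sum_(0 <= n < N.+1) eulerTerm c n =
  \sum_(0 <= n < N.+1) eulerTerm (c * q) n
   - c * q * \sum_(0 <= n < N) eulerTerm (c * q) n.
  rewrite mulr_sumr !big_nat_recl // !eulerTerm0 -addrA -sumrB; congr (_ + _).
  by apply: eq_bigr => n _; exact: eulerTerm_rec.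
rewrite -cvg_shiftS; under eq_fun do rewrite h.
rewrite mulrBl mul1r; apply: cvgB; last first.
  by apply: cvgM; [exact: cvg_cst | exact: cvg_euler].
rewrite (cvg_shiftS (fun N => \sum_(0 <= n < N) eulerTerm (c * q) n)).
exact: cvg_euler.
Qed.

Lemma eulerE c N : euler c = qpoch (c * q) q N * euler (c * q ^+ N).
Proof.
elim: N => [|N ->]; first by rewrite qpoch0 mul1r mulr1.
by rewrite qpochS euler_rec -!mulrA -!exprSr -exprS.
Qed.

Lemma small_euler_sub1 : small (fun c => euler c - 1).
Proof.
pose K := (1 - r)^-1.
(* One factor [K] comes from [y c], the other from the geometric sum in the constant and from the
   product bound in the exponent. *)
exists (K * K), (K * K); split; rewrite ?mulr_ge0 ?invr_ge0 ?(ltW h1r) // => c.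
pose M := y c * expR (y c / (1 - r)).
have M0 : 0 <= M by rewrite mulr_ge0 ?expR_ge0 // divr_ge0 ?normc_ge0 // ltW.
have : normc (euler c - 1) <= M / (1 - r).
  have h : (fun N => \sum_(0 <= n < N.+1) eulerTerm c n - 1) @ \oo -->
      (euler c - 1 : R[i]).
    have h' := @cvg_euler c; rewrite -cvg_shiftS in h'.
    exact: (cvgB h' (cvg_cst (1 : R[i]))).
  apply: (normc_lim_le h) => N; rewrite big_nat_recl // eulerTerm0 addrC addKr.
  have := @normc_sum_geometric R M r M0 r0 r1 (fun n => eulerTerm c n.+1) _ 0 N.
  rewrite expr0 mulr1; apply => n.
  rewrite (le_trans (normc_eulerTermS_small c n)) // ler_wpM2l // exprS.
  by rewrite ler_piMl ?exprn_ge0 // ltW.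
have eD : y c / (1 - r) = K * K * normc c by rewrite /K; ring.
by rewrite /M eD; congr (_ <= _); rewrite /K; ring.
Qed.

(** By [eulerE] the error is [qpoch (c * q) q N] times E(c q^N) - 1: the first factor is bounded
    uniformly in [N], the second is O(r^N) by [small_euler_sub1]. *)
Lemma cvg_qpoch c : (fun N => qpoch (c * q) q N) @ \oo --> euler c.
Proof.
have [K [D [K0 D0 hK]]] := small_euler_sub1.
pose P := 1 + (1 - r)^-1 * (normc (c * q) * expR ((1 - r)^-1 * normc (c * q))).
pose M := P * (K * (normc c * expR (D * normc c))).
have P1 N : normc (qpoch (c * q) q N) <= P.
  rewrite -[X in normc X](subKr 1) (le_trans (normc_triangle _ _)) //.
  by rewrite Normc.normc1 lerD2l normc_opp normc_qpoch_sub1.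
have P0 : 0 <= P by rewrite (le_trans _ (P1 0)) ?normc_ge0.
have M0 : 0 <= M by rewrite !mulr_ge0 ?expR_ge0 ?normc_ge0.
apply: (cvg_normc_le (v := fun N => M * r ^+ N)); last exact: cvg_geometric0.
move=> N; rewrite {1}(eulerE c N) -[X in _ - X]mulr1 -mulrBr Normc.normcM.
rewrite /M -[in leRHS]mulrA ler_pM ?normc_ge0 //.
rewrite (le_trans (hK _)) // Normc.normcM normcX -[leRHS]mulrA ler_wpM2l //.
rewrite [leRHS]mulrAC ler_wpM2l ?mulr_ge0 ?exprn_ge0 ?normc_ge0 //.
rewrite ler_expR ler_wpM2l // ler_piMr ?normc_ge0 //.
by rewrite exprn_ile1 // ltW.
Qed.

End Euler.

Lemma small_sum_from (R : realType) (s : R) (u : R[i] -> nat -> R[i])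
    (M D : R) :
  0 <= s -> s < 1 -> 0 <= M -> 0 <= D ->
  (forall c n, Normc.normc (u c n) <=
    M * (Normc.normc c * expR (D * Normc.normc c)) * s ^+ n) ->
  small (fun c => sum_from 0 (u c)).
Proof.
move=> s0 s1 M0 D0 hu; exists (M / (1 - s)), D.
split=> // [|c]; first by rewrite divr_ge0 // subr_ge0 ltW.
have B0 : 0 <= M * (Normc.normc c * expR (D * Normc.normc c)).
  by rewrite !mulr_ge0 ?normc_ge0 ?expR_ge0.
by rewrite mulrAC; exact: (normc_sum_from_le B0 s0 s1 (hu c)).
Qed.

(** * The q-difference equations of the two q-series expressions *)

Section TwoSeries.
Variables (R : realType) (q : R[i]).
Local Notation normc := (@Normc.normc R).
Local Notation r := (normc q).
Hypothesis r1 : r < 1.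
Let r0 : 0 <= r := normc_ge0 q.
Let h1r : 0 < 1 - r. Proof. by rewrite subr_gt0. Qed.
Let K := (1 - r)^-1.
Let K0 : 0 <= K. Proof. by rewrite invr_ge0 ltW. Qed.

Definition eulerLambertTerm (c : R[i]) n : R[i] :=
  (- c) ^+ n * q ^+ (n * n.+1)./2 / (qpoch q q n * (1 - q ^+ n)).

Lemma eulerLambertTermE c n :
  eulerLambertTerm c n = eulerTerm q c n / (1 - q ^+ n).
Proof. by rewrite /eulerLambertTerm /eulerTerm invfM mulrA. Qed.

(* 1 - q ^+ 0 = 0 has inverse 0, so the terms of index 0 vanish and all the  *)
(* series can be summed from 0.                                              *)
Lemma eulerLambertTerm0 c : eulerLambertTerm c 0 = 0.
Proof. by rewrite eulerLambertTermE expr0 subrr invr0 mulr0. Qed.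

Lemma normc_eulerLambertTerm_le c n :
  normc (eulerLambertTerm c n) <=
  K * K * (normc c * expR (K * K * normc c)) * r ^+ n.
Proof.
case: n => [|n].
  rewrite eulerLambertTerm0 Normc.normc0.
  by rewrite !mulr_ge0 ?expR_ge0 ?normc_ge0 ?exprn_ge0.
rewrite eulerLambertTermE Normc.normcM.
rewrite (le_trans (ler_pM (normc_ge0 _) (normc_ge0 _)
  (normc_eulerTermS_small r1 c n) (normc_inv_1subX r1 n.+1))) //.
rewrite -/K; have -> : normc c * K * K = K * K * normc c by ring.
by rewrite le_eqVlt; apply/orP; left; apply/eqP; ring.
Qed.

Lemma cvg_eulerLambertTerm c :
  (fun N => \sum_(0 <= n < N) eulerLambertTerm c n) @ \oo -->
  sum_from 0 (eulerLambertTerm c).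
Proof.
apply: (cvg_sum_from _ r0 r1 (normc_eulerLambertTerm_le c)).
by rewrite !mulr_ge0 ?expR_ge0 ?normc_ge0.
Qed.

Lemma small_eulerLambertTerm : small (fun c => sum_from 0 (eulerLambertTerm c)).
Proof.
by apply: small_sum_from r0 r1 _ _ normc_eulerLambertTerm_le; rewrite mulr_ge0.
Qed.

Lemma sum_eulerLambertTerm_qshift c :
  sum_from 0 (eulerLambertTerm c) - sum_from 0 (eulerLambertTerm (c * q)) =
  euler q c - 1.
Proof.
have h1 := @cvg_eulerLambertTerm c; have h2 := @cvg_eulerLambertTerm (c * q).
have h3 := cvgn_sub h1 h2.
rewrite -(cvgn_limE h3); apply: cvgn_limE.
have h4 := cvgn_sub (@cvg_euler _ _ r1 c) (cvg_cst (1 : R[i])).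
rewrite -cvg_shiftS; rewrite -cvg_shiftS in h4.
rewrite [X in X @ _](_ : _ =
  (fun N => \sum_(0 <= n < N.+1) eulerTerm q c n - 1)); first exact: h4.
apply/funext => N /=.
rewrite -sumrB !big_nat_recl // !eulerLambertTerm0 subrr add0r.
rewrite eulerTerm0 [RHS]addrAC subrr add0r.
(* The shift multiplies the term by [q ^+ n.+1], so the difference acquires the factor
   [1 - q ^+ n.+1], which cancels the extra denominator. *)
apply: eq_bigr => n _; rewrite !eulerLambertTermE eulerTerm_shift.
by have := subX_neq0 r1 n; set Q := q ^+ n.+1 => h; field.
Qed.

Definition divisorTerm n : R[i] := q ^+ n / (1 - q ^+ n).
Definition qpochTerm (c : R[i]) n : R[i] := qpoch c q n / (1 - q ^+ n) * q ^+ n.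
(** The last two series are merged termwise: neither is O(c) alone, but [1 - qpoch c q n] is,
    uniformly in [n]. *)
Definition diffTerm (c : R[i]) n : R[i] := (1 - qpoch c q n) * divisorTerm n.

Lemma normc_divisorTerm_le n : normc (divisorTerm n) <= K * r ^+ n.
Proof.
rewrite Normc.normcM normcX mulrC ler_wpM2r ?exprn_ge0 //.
exact: normc_inv_1subX.
Qed.

Lemma divisorTerm0 : divisorTerm 0 = 0.
Proof. by rewrite /divisorTerm expr0 subrr invr0 mulr0. Qed.

Lemma cvg_divisorTerm :
  (fun N => \sum_(0 <= n < N) divisorTerm n) @ \oo --> sum_from 0 divisorTerm.
Proof. exact: (cvg_sum_from K0 r0 r1 normc_divisorTerm_le). Qed.

Lemma normc_diffTerm_le c n :
  normc (diffTerm c n) <= K * K * (normc c * expR (K * normc c)) * r ^+ n.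
Proof.
rewrite Normc.normcM (le_trans (ler_pM (normc_ge0 _) (normc_ge0 _)
  (normc_qpoch_sub1 r1 c n) (normc_divisorTerm_le n))) // -/K.
by rewrite le_eqVlt; apply/orP; left; apply/eqP; ring.
Qed.

Lemma cvg_diffTerm c :
  (fun N => \sum_(0 <= n < N) diffTerm c n) @ \oo --> sum_from 0 (diffTerm c).
Proof.
apply: (cvg_sum_from _ r0 r1 (normc_diffTerm_le c)).
by rewrite !mulr_ge0 ?expR_ge0 ?normc_ge0.
Qed.

Lemma small_diffTerm : small (fun c => sum_from 0 (diffTerm c)).
Proof.
by apply: small_sum_from r0 r1 _ _ normc_diffTerm_le; rewrite ?mulr_ge0.
Qed.

Lemma sum_diffTerm_qshift c :
  sum_from 0 (diffTerm c) - sum_from 0 (diffTerm (c * q)) = 1 - euler q c.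
Proof.
have h1 := @cvg_diffTerm c; have h2 := @cvg_diffTerm (c * q).
have h3 := cvgn_sub h1 h2.
rewrite -(cvgn_limE h3); apply: cvgn_limE.
have h4 := cvgn_sub (cvg_cst (1 : R[i])) (@cvg_qpoch _ _ r1 c).
rewrite -cvg_shiftS.
rewrite [X in X @ _](_ : _ = (fun N => 1 - qpoch (c * q) q N)); first exact: h4.
apply/funext => N /=.
rewrite -sumrB big_nat_recl // /diffTerm divisorTerm0 !mulr0 subrr add0r.
(* The two q-factorials share the factor [qpoch (c * q) q n]. What remains is [c * (1 - q ^+ n.+1)],
   so each term is a difference of consecutive values of [qpoch (c * q) q]. *)
rewrite (telescope_sumr_eq (fun n => - qpoch (c * q) q n)) //.
  by rewrite qpoch0 opprK addrC.
move=> n _; rewrite qpoch_recl qpochS /divisorTerm.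
have := subX_neq0 r1 n; rewrite exprS; set Q := q ^+ n => h.
by field.
Qed.

Lemma cvg_qpochTerm c :
  (fun N => \sum_(0 <= n < N) qpochTerm c n) @ \oo -->
  (sum_from 0 divisorTerm - sum_from 0 (diffTerm c) : R[i]).
Proof.
have h := cvgn_sub cvg_divisorTerm (@cvg_diffTerm c).
rewrite [X in X @ _](_ : _ = (fun N => \sum_(0 <= n < N) divisorTerm n -
   \sum_(0 <= n < N) diffTerm c n)); first exact: h.
apply/funext => N; rewrite -sumrB; apply: eq_bigr => n _.
by rewrite /qpochTerm /diffTerm /divisorTerm; ring.
Qed.

End TwoSeries.

(** The conjunct [j <= n] reflects the starting value [n] of the minimum; it matters only when [p]
    is empty. *)
Lemma leq_smallest_part n (p : {set 'I_n.+1}) j :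
  (j <= smallest_part p)%N = (j <= n)%N && [forall i in p, (j <= i)%N].
Proof.
have -> : [forall i in p, (j <= i)%N] =
    all (fun i => (i \in p) ==> (j <= i)%N) (index_enum 'I_n.+1).
  apply/forall_inP/allP => h i; first by move=> _; apply/implyP; exact: h.
  by move=> ip; exact: implyP (h i (mem_index_enum i)) ip.
rewrite /smallest_part; elim: index_enum => [|i s IH].
  by rewrite big_nil andbT.
by rewrite big_cons /=; case: ifP => // _; rewrite leq_min IH andbCA.
Qed.

(** * Polynomial generating functions for partitions into distinct parts *)

Section FFWPoly.
Variable S : comNzRingType.

Definition tailProd (a : S) m n : {poly S} :=
  \prod_(m <= k < n) (1 + a *: 'X^k).

(** A nonempty partition with parts at most [N] is counted once for each [j] from 1 to its smallest
    part, which produces the weight s; subtracting 1 discards the empty partition. The ring is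
    arbitrary so that a real polynomial can majorize the complex one. *)
Definition ffwPoly (a : S) N : {poly S} :=
  \sum_(1 <= j < N.+1) (tailProd a j N.+1 - 1).

Lemma tailProdE (a : S) j n : tailProd a j n =
  \sum_(p : {set 'I_n} | [forall i in p, (j <= i)%N])
    a ^+ #|p| *: 'X^(\sum_(i in p) i).
Proof.
rewrite /tailProd (big_nat_widenl _ 0) //= big_mkcond big_mkord.
(* Factors of index below [j] are written 0 + 1: the product then expands over all subsets, and
   those with an element below [j] contribute 0. *)
transitivity
  (\prod_(i < n) ((if (j <= i)%N then a *: 'X^i else 0) + 1) : {poly S}).
  by apply: eq_bigr => i _; case: ifP => _; rewrite ?add0r // addrC.
rewrite bigA_distr [RHS]big_mkcond; apply: eq_bigr => p _.
rewrite -big_mkcond /=; case: ifP => [/forall_inP h|/negbT].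
  rewrite (eq_bigr (fun i : 'I_n => a *: 'X^i)) => [|i /h -> //].
  by rewrite scaler_prod prodr_const prodrXr.
rewrite negb_forall; case/existsP => i.
rewrite negb_imply => /andP[ip /negbTE ji].
by rewrite (bigD1 i) //= ji mul0r.
Qed.

(** Raising the bound on the parts only introduces parts larger than [n], which cannot occur in
    degree [n]. *)
Lemma coef_ffwPoly_recr (a : S) N n : (n <= N)%N ->
  (ffwPoly a N)`_n = (ffwPoly a n)`_n.
Proof.
move=> /subnK <-; elim: (N - n)%N => // d <-; rewrite addSn.
set m := (d + n)%N; have mn : (n < m.+1)%N by rewrite ltnS leq_addl.
rewrite /ffwPoly big_nat_recr //= coefD !coef_sum.
have t j : (j <= m.+1)%N ->
  (tailProd a j m.+2 - 1)`_n = (tailProd a j m.+1 - 1)`_n.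
  move=> jm; rewrite /tailProd big_nat_recr //= mulrDr mulr1 -scalerAr.
  by rewrite !coefB coefD coefZ coefMXn mn mulr0 addr0.
rewrite t // /tailProd big_geq // subrr coef0 addr0.
by apply: eq_big_nat => j /andP[_ jm]; rewrite t // ltnW.
Qed.

Lemma coef_ffwPoly (a : S) n : (0 < n)%N ->
  (ffwPoly a n)`_n =
  \sum_(p in distinct_partitions n) a ^+ num_parts p * (smallest_part p)%:R.
Proof.
move=> n0; rewrite coef_sum.
transitivity (\sum_(1 <= j < n.+1)
  \sum_(p : {set 'I_n.+1} | (\sum_(i in p) i == n)%N)
    if (j <= smallest_part p)%N then a ^+ #|p| else 0).
  apply: eq_big_nat => j /andP[_ jn].
  rewrite coefB coef1 (gtn_eqF n0) subr0 tailProdE coef_sumMXn.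
  rewrite -big_mkcondr /=; apply: eq_bigl => p.
  by rewrite leq_smallest_part -ltnS jn andbC.
rewrite exchange_big /= big_mkcond [RHS]big_mkcond /=.
apply: eq_bigr => p _; rewrite inE andbC; case: ifP => //= _.
have sn : (smallest_part p <= n)%N.
  by have := leqnn (smallest_part p); rewrite leq_smallest_part => /andP[].
rewrite -big_mkcond /=.
transitivity (\sum_(1 <= j < (smallest_part p).+1) a ^+ #|p|).
  by rewrite [RHS](big_nat_widen _ _ n.+1).
(* The expansion also ranges over sets containing 0, which are not partitions; their smallest part
   is 0, so they contribute nothing. *)
rewrite sumr_const_nat subn1 /= mulr_natr; case: ifP => // /negbFE p0.
have := leqnn (smallest_part p); rewrite leq_smallest_part => /andP[_].
by move=> /forall_inP/(_ _ p0); rewrite leqn0 => /eqP ->.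
Qed.

Lemma horner_tailProd (a x : S) m n :
  (tailProd a m n).[x] = \prod_(m <= k < n) (1 + a * x ^+ k).
Proof.
rewrite horner_prod; apply: eq_bigr => k _.
by rewrite hornerE hornerZ hornerXn hornerC.
Qed.

Lemma horner_ffwPoly (a x : S) N : (ffwPoly a N).[x] =
  \sum_(1 <= j < N.+1) (\prod_(j <= k < N.+1) (1 + a * x ^+ k) - 1).
Proof.
rewrite horner_sum; apply: eq_bigr => j _.
by rewrite hornerD hornerN hornerC horner_tailProd.
Qed.

(** Replacing [a] by [a * x] shifts the exponents of a tail product by one, so all summands cancel
    except the one for j = 1. *)
Lemma horner_ffwPoly_recl (a x : S) N :
  (ffwPoly a N.+1).[x] - (ffwPoly (a * x) N).[x] =
  \prod_(1 <= k < N.+2) (1 + a * x ^+ k) - 1.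
Proof.
rewrite !horner_ffwPoly [in X in X - _]big_nat_recl //=.
rewrite [X in _ + X - _](_ : _ = \sum_(1 <= j < N.+1)
  (\prod_(j <= k < N.+1) (1 + a * x * x ^+ k) - 1)).
  by rewrite addrK.
apply: eq_bigr => j _; rewrite big_add1 /=; congr (_ - _).
by apply: eq_bigr => k _; rewrite exprS mulrA.
Qed.

End FFWPoly.

Lemma FFW_coef (R : realType) (c : R[i]) n : FFW c n = - (ffwPoly (- c) n)`_n.
Proof.
case: n => [|n]; first by rewrite /ffwPoly big_geq // coef0 oppr0.
by rewrite coef_ffwPoly.
Qed.

(** Each coefficient is a polynomial in [a] with nonnegative integer coefficients. *)
Lemma normc_coef_tailProd (R : realType) (a : R[i]) m n i :
  Normc.normc (tailProd a m n - 1)`_i <= (tailProd (Normc.normc a) m n - 1)`_i.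
Proof.
elim: n i => [|n IH] i.
  by rewrite /tailProd !big_geq // !subrr !coef0 Normc.normc0.
have [mn|nm] := leqP m n; last first.
  by rewrite /tailProd !big_geq // !subrr !coef0 Normc.normc0.
have e (T : comNzRingType) (b : T) : (tailProd b m n.+1 - 1)`_i =
  (tailProd b m n - 1)`_i +
  (b * (if (i < n)%N then 0 else (tailProd b m n - 1)`_(i - n))
   + b * (i == n)%:R).
  rewrite /tailProd big_nat_recr //=; set p := \prod_(m <= k < n) _.
  have -> : p * (1 + b *: 'X^n) - 1 =
    (p - 1) + (b *: ((p - 1) * 'X^n) + b *: 'X^n).
    by rewrite mulrDr mulr1 -scalerAr mulrBl mul1r scalerBr subrK addrAC.
  by rewrite coefD; congr (_ + _); rewrite coefD !coefZ coefMXn coefXn.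
rewrite !e; apply: le_trans (normc_triangle _ _) _.
apply: lerD; first exact: IH.
apply: le_trans (normc_triangle _ _) _; apply: lerD.
  rewrite Normc.normcM ler_wpM2l ?normc_ge0 //.
  by case: ifP => _; rewrite ?Normc.normc0 ?IH.
rewrite Normc.normcM ler_wpM2l ?normc_ge0 //.
by case: (i == n); rewrite ?Normc.normc1 ?Normc.normc0.
Qed.

Lemma normc_coef_ffwPoly (R : realType) (a : R[i]) N i :
  Normc.normc (ffwPoly a N)`_i <= (ffwPoly (Normc.normc a) N)`_i.
Proof.
rewrite !coef_sum (le_trans (normc_sum _ _ _)) // ler_sum // => j _.
exact: normc_coef_tailProd.
Qed.

Lemma coefX_le_horner (R : numDomainType) (p : {poly R}) (x : R) n :
  (forall i, 0 <= p`_i) -> 0 <= x -> p`_n * x ^+ n <= p.[x].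
Proof.
move=> p0 x0.
have t0 i : 0 <= p`_i * x ^+ i by rewrite mulr_ge0 ?exprn_ge0.
rewrite (horner_coef_wide x (leq_maxl (size p) n.+1)).
have hn : (n < maxn (size p) n.+1)%N by rewrite leq_maxr.
by rewrite (bigD1 (Ordinal hn)) //= lerDl sumr_ge0.
Qed.

(** * The generating function of [FFW] as a limit of polynomial values *)

Section FFWSeries.
Variables (R : realType) (q : R[i]).
Local Notation normc := (@Normc.normc R).
Local Notation r := (normc q).
Hypothesis r1 : r < 1.
Let r0 : 0 <= r := normc_ge0 q.

(* The coefficients are bounded by the value at some s > r of a majorant      *)
(* polynomial; this makes the terms at q geometric of ratio rho = r / s.      *)
Let s : R := (1 + r) / 2.
Let rho : R := r / s.

Let s0 : 0 < s.
Proof. by rewrite /s divr_gt0 // ltr_pwDl. Qed.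

Let s1 : s < 1.
Proof. by rewrite /s; have := r1; lra. Qed.

Let rho0 : 0 <= rho.
Proof. by rewrite divr_ge0 // ltW. Qed.

Let rho1 : rho < 1.
Proof. by rewrite ltr_pdivrMr // mul1r /s; have := r1; lra. Qed.

Let K := (1 - s)^-1.
Let K0 : 0 <= K.
Proof. by rewrite invr_ge0 subr_ge0 ltW. Qed.

Let M c := K * K * (normc c * expR (K * normc c)).

Let M0 c : 0 <= M c.
Proof. by rewrite !mulr_ge0 ?expR_ge0 ?normc_ge0. Qed.

(** The bound is independent of [N], so it controls both the series and the tails of the polynomials
    approximating it. *)
Lemma normc_ffwPoly_term_le c N n :
  normc ((ffwPoly (- c) N)`_n * q ^+ n) <= M c * rho ^+ n.
Proof.
have s0' := ltW s0.
have coef_ge0 i : 0 <= (ffwPoly (normc c) N)`_i.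
  rewrite -(normc_opp c).
  exact: le_trans (normc_ge0 _) (normc_coef_ffwPoly _ _ _).
have rE : r = s * rho by rewrite /rho mulrC divfK // gt_eqF.
rewrite Normc.normcM normcX rE exprMn mulrA ler_wpM2r ?exprn_ge0 //.
apply: le_trans (_ : (ffwPoly (normc c) N)`_n * s ^+ n <= _).
  rewrite ler_wpM2r ?exprn_ge0 // -(normc_opp c).
  exact: normc_coef_ffwPoly.
rewrite (le_trans (coefX_le_horner _ coef_ge0 s0')) // horner_ffwPoly.
apply: le_trans (ler_sum _ (fun j _ =>
  prod_sub1_le (normc_ge0 c) s0' s1 j N.+1)) _.
rewrite -mulr_sumr.
rewrite -/K; have -> : M c = normc c * K * expR (normc c * K) * K.
  by rewrite /M [K * normc c]mulrC; ring.
rewrite ler_wpM2l ?mulr_ge0 ?normc_ge0 ?expR_ge0 //.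
apply: le_trans (geometric_sum_le s0' s1 1 N.+1) _.
by rewrite expr1 ler_piMl ?(ltW s1) ?K0.
Qed.

Definition ffwTerm c n : R[i] := FFW c n * q ^+ n.

Lemma ffwTermE c N n : (n <= N)%N ->
  ffwTerm c n = - ((ffwPoly (- c) N)`_n * q ^+ n).
Proof.
by move=> nN; rewrite /ffwTerm FFW_coef (coef_ffwPoly_recr _ nN) mulNr.
Qed.

Lemma normc_ffwTerm_le c n : normc (ffwTerm c n) <= M c * rho ^+ n.
Proof. by rewrite (ffwTermE c (leqnn n)) normc_opp normc_ffwPoly_term_le. Qed.

Lemma cvg_ffwTerm c :
  (fun N => \sum_(0 <= n < N) ffwTerm c n) @ \oo --> sum_from 0 (ffwTerm c).
Proof. exact: (cvg_sum_from (M0 c) rho0 rho1 (normc_ffwTerm_le c)). Qed.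

Lemma small_ffwTerm : small (fun c => sum_from 0 (ffwTerm c)).
Proof.
by apply: small_sum_from rho0 rho1 _ _ normc_ffwTerm_le; rewrite ?mulr_ge0.
Qed.

Lemma cvg_ffwPoly c :
  (fun N => - (ffwPoly (- c) N).[q]) @ \oo --> sum_from 0 (ffwTerm c).
Proof.
have h1 := @cvg_ffwTerm c; rewrite -cvg_shiftS in h1.
(* In degrees at most [N] the polynomial cancels the partial sum exactly; only its terms of higher
   degree remain, and they are O(rho^N). *)
pose D N := \sum_(0 <= n < N.+1) ffwTerm c n + (ffwPoly (- c) N).[q].
have h2 : D @ \oo --> (0 : R[i]).
  apply: (cvg_normc_le (v := fun N => M c / (1 - rho) * rho ^+ N)); last first.
    by apply: cvg_geometric0 => //; rewrite divr_ge0 // subr_ge0 ltW.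
  move=> N; rewrite sub0r normc_opp /D.
  set p := ffwPoly (- c) N.
  rewrite (horner_coef_wide q (leq_maxl (size p) N.+1)).
  rewrite -(big_mkord xpredT (fun i => p`_i * q ^+ i)).
  rewrite (big_cat_nat (leq0n N.+1) (leq_maxr (size p) N.+1)) /= addrA.
  rewrite -big_split big_nat big1 => [|n /andP[_ nN]]; last first.
    by rewrite (ffwTermE c (N:=N)) //= addNr.
  rewrite add0r (le_trans (normc_sum_geometric (M0 c) rho0 rho1
    (normc_ffwPoly_term_le c N) _ _)) // mulrAC ler_wpM2l //.
    by rewrite divr_ge0 // subr_ge0 ltW.
  by rewrite exprS ler_piMl ?exprn_ge0 // ltW.
have h3 := cvgn_sub h1 h2; rewrite subr0 in h3.
rewrite [X in X @ _](_ : _ = (fun N => \sum_(0 <= n < N.+1) ffwTerm c n - D N)).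
  exact: h3.
by apply/funext => N; rewrite /D opprD addNKr.
Qed.

Lemma sum_ffwTerm_qshift c :
  sum_from 0 (ffwTerm c) - sum_from 0 (ffwTerm (c * q)) = 1 - euler q c.
Proof.
have h1 := @cvg_ffwPoly c; rewrite -cvg_shiftS in h1.
have h := cvgn_sub h1 (@cvg_ffwPoly (c * q)).
rewrite -(cvgn_limE h); apply: cvgn_limE.
have h2 := @cvg_qpoch _ _ r1 c; rewrite -cvg_shiftS in h2.
have h3 := cvgn_sub (cvg_cst (1 : R[i])) h2.
rewrite [X in X @ _](_ : _ = (fun N => 1 - qpoch (c * q) q N.+1)).
  exact: h3.
apply/funext => N /=; rewrite opprK addrC -[LHS]opprB -mulNr.
rewrite horner_ffwPoly_recl opprB; congr (_ - _).
rewrite big_add1 /= big_mkord /qpoch; apply: eq_bigr => k _.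
by rewrite mulNr exprS mulrA.
Qed.

End FFWSeries.

Lemma sum_from1E (R : realType) (u : nat -> R[i]) (l : R[i]) : u 0 = 0 ->
  (fun N => \sum_(0 <= n < N) u n) @ \oo --> l ->
  summable_from 1 u /\ sum_from 1 u = l.
Proof.
move=> u0; rewrite -cvg_shiftS => h.
have h1 : (fun N => \sum_(1 <= n < N) u n) @ \oo --> l.
  rewrite -cvg_shiftS.
  rewrite [X in X @ _](_ : _ = (fun N => \sum_(0 <= n < N.+1) u n)).
    exact: h.
  by apply/funext => N /=; rewrite [RHS]big_ltn // u0 add0r.
by split; [exact: cvgP h1 | exact: cvgn_limE h1].
Qed.

Theorem theorem1p16 (R : realType) (c q : R[i]) (hq : `|q| < 1) :
  let a n := FFW c n * q ^+ n in
  let b n := (- c) ^+ n * q ^+ (n * n.+1)./2 / (qpoch q q n * (1 - q ^+ n)) in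
  let d n := q ^+ n / (1 - q ^+ n) in
  let e n := qpoch c q n / (1 - q ^+ n) * q ^+ n in
  [/\ summable_from 0 a, summable_from 1 b,
      summable_from 1 d & summable_from 1 e] /\
  (sum_from 0 a = - sum_from 1 b /\
   - sum_from 1 b = sum_from 1 d - sum_from 1 e).
Proof.
have r1 : Normc.normc q < 1 by move: hq; rewrite normcEC ltcR.
move=> a b d e.
rewrite -[a]/(ffwTerm q c) -[b]/(eulerLambertTerm q c).
rewrite -[d]/(divisorTerm q) -[e]/(qpochTerm q c).
clear a b d e.
have e0 : qpochTerm q c 0 = 0.
  by rewrite /qpochTerm expr0 subrr invr0 mulr0 mul0r.
have [sb ->] :=
  sum_from1E (eulerLambertTerm0 q c) (@cvg_eulerLambertTerm _ _ r1 c).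
have [sd ->] := sum_from1E (divisorTerm0 q) (@cvg_divisorTerm _ _ r1).
have [se ->] := sum_from1E e0 (@cvg_qpochTerm _ _ r1 c).
have sa : summable_from 0 (ffwTerm q c) := cvgP _ (@cvg_ffwTerm _ _ r1 c).
split; first exact: And4 sa sb sd se.
(* The series of [qpochTerm] was evaluated as the divisor series minus the [diffTerm] series, so the
   last expression reduces to the latter. *)
rewrite subKr.
have small_opp_b : small (fun c => - sum_from 0 (eulerLambertTerm q c)).
  have [K [D [K0 D0 h]]] := small_eulerLambertTerm r1.
  by exists K, D; split => // x; rewrite normc_opp.
have opp_b_rec x : - sum_from 0 (eulerLambertTerm q x)
    - (- sum_from 0 (eulerLambertTerm q (x * q))) =
    1 - euler q x.
  by rewrite -opprD (sum_eulerLambertTerm_qshift r1) opprB.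
split.
  apply: (small_q_shift_unique r1 (small_ffwTerm r1) small_opp_b) => x.
  by rewrite (sum_ffwTerm_qshift r1) opp_b_rec.
apply: (small_q_shift_unique r1 small_opp_b (small_diffTerm r1)) => x.
by rewrite (sum_diffTerm_qshift r1) opp_b_rec.
Qed.
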